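(* Let $\alpha>0$. For all $m\in\mathbb N$ and all $k\in\mathbb N_0$ one has $\mathcal L_{m,k}=\mathcal M_{m,k}$, where $$\mathcal L_{m,k}:=\operatorname{span}\left\{\widehat L_{m,j}^{I,\alpha}: j=m,m+1,\ldots,m+k\right\}$$ is the span of the first $k+1$ Type I $X_m$ exceptional Laguerre polynomials, and $$\mathcal M_{m,k}:=\left\{p\in\mathcal P_{m+k}:\ \xi_j\,p'(\xi_j)+\alpha\,p(\xi_j)=0\ \text{ for } j=1,2,\ldots,m\right\},$$ with $\xi_1,\ldots,\xi_m$ the $m$ (simple, real) roots of the polynomial $x\mapsto L_m^{\alpha-1}(-x)$.
   Context: $\mathbb N=\{1,2,\ldots\}$ and $\mathbb N_0=\mathbb N\cup\{0\}$. $\mathcal P_{d}$ denotes the set of all polynomials of degree at most $d$. $L_n^{\beta}(x)$ denotes the classical Laguerre polynomial of degree $n$ with parameter $\beta$, i.e. $L_n^{\beta}(x)=\sum_{i=0}^n \binom{n+\beta}{n-i}\frac{(-x)^i}{i!}$, with the convention $L_{-1}^{\beta}=0$. For $n\ge m$, the Type I $X_m$ exceptional Laguerre polynomial of degree $n$ with parameter $\alpha$ is $$\widehat L_{m,n}^{I,\alpha}(x)=L_m^{\alpha}(-x)\,L_{n-m}^{\alpha-1}(x)+L_m^{\alpha-1}(-x)\,L_{n-m-1}^{\alpha}(x).$$ These polynomials are eigenfunctions, $\widehat\ell_m^{I,\alpha}[y]=(n-m)y$ on $(0,\infty)$, of the differential expression $$\widehat\ell_m^{I,\alpha}[y](x)=-xy''(x)+\left(x-\alpha-1+2x\left(\log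 L_m^{\alpha-1}(-x)\right)'\right)y'(x)+\left(2\alpha\left(\log L_m^{\alpha-1}(-x)\right)'-m\right)y(x).$$ *)

(* Defs.v *)
From mathcomp Require Import all_boot all_order all_algebra.
From mathcomp Require Import all_classical all_reals.
Set Implicit Arguments.
Unset Strict Implicit.
Unset Printing Implicit Defensive.
Import Order.TTheory GRing.Theory Num.Theory.
Local Open Scope classical_set_scope.
Local Open Scope ring_scope.

(* Generalized binomial coefficient x (x - 1) ... (x - k + 1) / k! with a real
   upper argument. *)
Definition gbinom (R : realType) (x : R) (k : nat) : R :=
  (\prod_(j < k) (x - j%:R)) / (k`!)%:R.

(* The degree is an int so that the convention L_{-1}^b = 0 can be expressed;
   no degree below -1 is ever used. *)
Definition laguerre (R : realType) (b : R) (n : int) : {poly R} :=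
  match n with
  | Posz n => \sum_(i < n.+1)
      (gbinom (n%:R + b) (n - i) / (i`!)%:R) *: (- 'X) ^+ i
  | Negz _ => 0
  end.

(* The polynomial x |-> L_n^b(-x). *)
Definition laguerre_neg (R : realType) (b : R) (n : int) : {poly R} :=
  laguerre b n \Po (- 'X).

(* Only meant for m <= n. *)
Definition xlaguerreI (R : realType) (m : nat) (a : R) (n : nat) : {poly R} :=
  laguerre_neg a m%:Z * laguerre (a - 1) (n%:Z - m%:Z) +
  laguerre_neg (a - 1) m%:Z * laguerre a (n%:Z - m%:Z - 1).

(* P_d; the size of a nonzero polynomial is its degree plus one. *)
Definition poly_deg_le (R : realType) (d : nat) : set {poly R} :=
  [set p | (size p <= d.+1)%N].

(* {poly R} is infinite-dimensional, so the span is the set of linear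
   combinations rather than a {vspace _}. *)
Definition spanXL (R : realType) (a : R) (m k : nat) : set {poly R} :=
  [set p | exists c : nat -> R,
     p = \sum_(m <= j < (m + k).+1) c j *: xlaguerreI m a j].

(* The nodes xi_1, ..., xi_m are the roots of x |-> L_m^(a-1)(-x). *)
Definition condXL (R : realType) (a : R) (m k : nat) : set {poly R} :=
  [set p | poly_deg_le (m + k) p /\
     forall xi : R, root (laguerre_neg (a - 1) m%:Z) xi ->
       xi * p^`().[xi] + a * p.[xi] = 0].

(* Main.v *)
Require Import Defs.
From mathcomp Require Import all_boot all_order all_algebra.
From mathcomp Require Import all_classical all_reals.
From mathcomp Require Import polyrcf ring lra zify.
Import Order.TTheory GRing.Theory Num.Theory.
Local Open Scope classical_set_scope.
Local Open Scope ring_scope.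

(** Write [w] for the polynomial L_m^(alpha-1)(-x), whose roots are the nodes.

    The relations L_m^alpha(-x) = w + w' and L_(N-1)^alpha = - f', where
    f = L_N^(alpha-1), turn the exceptional polynomial of degree m + N into
    (w + w') f - w f' ([xlaguerreIE]).  At a root xi of [w] its value is
    w'(xi) f(xi) and its derivative is (w' + w'')(xi) f(xi), so that the
    condition at xi becomes f(xi) (x w'' + (alpha + x) w')(xi) = 0.  This is
    the Laguerre equation x w'' + (alpha + x) w' = m w evaluated at xi
    ([laguerre_neg_ode], [xlaguerreI_cond]).  Hence the span satisfies the
    conditions.

    Conversely, the exceptional polynomials have the consecutive degrees
    m, ..., m + k ([size_xlaguerreI]), so any [p] of degree at most m + k can be
    reduced modulo their span to some [r] of degree less than m
    ([reduce_graded]).  If [p] satisfies the conditions then so does [r], that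
    is, x r' + alpha r vanishes at the m nodes; its degree is less than m, so it
    is zero; and x r' + alpha r multiplies the coefficient of x^i by
    i + alpha > 0, so r = 0 ([euler_cond_eq0]).

    The converse relies on [w] having m distinct real roots
    ([laguerre_neg_roots]).  This is proved without orthogonality, by
    induction on the degree for all parameters b > -1 at once:
    (n+1) L_(n+1)^b(-x) = x P' + (b + 1 + x) P with P = L_n^(b+1)(-x), and the
    right-hand side alternates in sign along 0, the n negative roots of [P] in
    decreasing order, and a point far to the left. *)

(** * Generalized binomial coefficients *)

Lemma gbinom0 (R : realType) (x : R) : gbinom x 0 = 1.
Proof. by rewrite /gbinom big_ord0 fact0 divr1. Qed.

Lemma natr_fact_succ_neq0 (R : realType) (k : nat) :
  (k`!%:R != 0 :> R) /\ (1 + k%:R != 0 :> R).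
Proof. by rewrite [1 + _]addrC natr1 !pnatr_eq0 -lt0n fact_gt0. Qed.

Lemma gbinomS (R : realType) (x : R) (k : nat) :
  k.+1%:R * gbinom x k.+1 = (x - k%:R) * gbinom x k.
Proof.
have [k0 Sk0] := natr_fact_succ_neq0 R k.
rewrite /gbinom big_ord_recr /= factS natrM; field.
by rewrite k0 Sk0.
Qed.

Lemma gbinom_pascal (R : realType) (x : R) (k : nat) :
  gbinom (x + 1) k.+1 = gbinom x k.+1 + gbinom x k.
Proof.
have [k0 Sk0] := natr_fact_succ_neq0 R k.
rewrite /gbinom big_ord_recl big_ord_recr /= factS natrM subr0.
under eq_bigr => i _ do rewrite /bump /= add1n -natr1 opprD addrACA subrr addr0.
field.
by rewrite k0 Sk0.
Qed.

(** * Laguerre polynomials of the reflected argument *)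

Lemma coef_laguerre_neg (R : realType) (b : R) (n i : nat) :
  (laguerre_neg b n%:Z)`_i =
  if (i <= n)%N then gbinom (n%:R + b) (n - i) / i`!%:R else 0.
Proof.
rewrite -ltnS -(coef_poly n.+1 (fun i => gbinom (n%:R + b) (n - i) / i`!%:R)).
congr (_`_i); rewrite /laguerre_neg /laguerre raddf_sum poly_def /=.
under eq_bigr => j _ do
  rewrite linearZ /= rmorphXn /= rmorphN /= comp_polyX opprK.
by [].
Qed.

Lemma comp_polyNXK (R : realType) : involutive (fun p : {poly R} => p \Po - 'X).
Proof. by move=> p; rewrite -comp_polyA rmorphN /= comp_polyX opprK comp_polyXr. Qed.

Lemma laguerreE (R : realType) (b : R) (n : int) :
  laguerre b n = laguerre_neg b n \Po - 'X.
Proof. by rewrite /laguerre_neg comp_polyNXK. Qed.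

Lemma size_laguerre_neg (R : realType) (b : R) (n : nat) :
  size (laguerre_neg b n%:Z) = n.+1.
Proof.
apply/eqP; rewrite eqn_leq; apply/andP; split.
  by apply/leq_sizeP => i; rewrite coef_laguerre_neg; case: leqP.
rewrite ltnNge; apply/negP => /leq_sizeP /(_ n (leqnn n)).
rewrite coef_laguerre_neg leqnn subnn gbinom0 div1r => /eqP.
by rewrite invr_eq0 (negPf (natr_fact_succ_neq0 R n).1).
Qed.

Lemma lead_coef_laguerre_neg_gt0 (R : realType) (b : R) (n : nat) :
  0 < lead_coef (laguerre_neg b n%:Z).
Proof.
rewrite lead_coefE size_laguerre_neg /= coef_laguerre_neg leqnn subnn gbinom0.
by rewrite div1r invr_gt0 ltr0n fact_gt0.
Qed.

Lemma deriv_laguerre_neg (R : realType) (b : R) (n : nat) :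
  (laguerre_neg b n.+1%:Z)^`() = laguerre_neg (b + 1) n%:Z.
Proof.
apply/polyP => i; rewrite coef_deriv !coef_laguerre_neg ltnS subSS.
case: ifP => _; last by rewrite mul0rn.
have [i0 Si0] := natr_fact_succ_neq0 R i.
rewrite factS natrM -(natr1 n) -addrA [1 + b]addrC -(mulr_natr _ i.+1).
by field; rewrite i0 Si0.
Qed.

(** The Pascal rule read on coefficients. *)
Lemma laguerre_neg_param (R : realType) (b : R) (n : nat) :
  laguerre_neg (b + 1) n%:Z =
  laguerre_neg b n%:Z + (laguerre_neg b n%:Z)^`().
Proof.
apply/polyP => i; rewrite coefD coef_deriv !coef_laguerre_neg.
case: (ltngtP i n) => [lt_in|_|->]; last 1 first.
- by rewrite subnn !gbinom0 mul0rn addr0.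
- have [i0 Si0] := natr_fact_succ_neq0 R i.
  rewrite -(subnSK lt_in) addrA gbinom_pascal factS natrM -(mulr_natr _ i.+1).
  by field; rewrite i0 Si0.
- by rewrite mul0rn addr0.
Qed.

Lemma coef_derivE (R : nzRingType) (p : {poly R}) (i : nat) :
  p^`()`_i = p`_i.+1 * i.+1%:R.
Proof. by rewrite coef_deriv mulr_natr. Qed.

(** Comparing coefficients of x^i, the equation is the recurrence
    (i+1) (i+b+1) c_(i+1) = (n-i) c_i, an instance of [gbinomS]. *)
Lemma laguerre_neg_ode (R : realType) (b : R) (n : nat) (w := laguerre_neg b n%:Z) :
  'X * w^`()^`() + ((b + 1)%:P + 'X) * w^`() = n%:R *: w.
Proof.
apply/polyP => i; rewrite mulrDl !coefD coefZ coefCM !coefXM.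
have -> : (if i == 0%N then 0 else w^`()^`()`_i.-1) = w`_i.+1 * i.+1%:R * i%:R.
  by case: i => [|i] /=; rewrite ?mulr0 // ?coef_derivE.
have -> : (if i == 0%N then 0 else w^`()`_i.-1) = w`_i * i%:R.
  by case: i => [|i] /=; rewrite ?mulr0 // ?coef_derivE.
rewrite coef_derivE /w !coef_laguerre_neg.
case: (ltngtP i n) => [lt_in|_|->]; last 1 first.
- by rewrite subnn; ring.
- have [i0 Si0] := natr_fact_succ_neq0 R i.
  have := gbinomS R (n%:R + b) (n - i.+1); rewrite subnSK // natrB; last exact: ltnW.
  have -> : (n - i.+1)%:R = n%:R - i%:R - 1 :> R.
    by rewrite natrB // -natr1; ring.
  set g := gbinom _ (n - i); set h := gbinom _ _ => gh.
  rewrite factS natrM -natr1.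
  have -> : h / ((i%:R + 1) * (i`!)%:R) * (i%:R + 1) = h / i`!%:R.
    by field; rewrite i0 addrC Si0.
  apply/eqP; rewrite -subr_eq0; apply/eqP.
  transitivity (((n%:R + b - (n%:R - i%:R - 1)) * h - (n%:R - i%:R) * g) / i`!%:R).
    by ring.
  by rewrite -gh subrr mul0r.
- by ring.
Qed.

(** The Laguerre equation for L_(n+1)^b(-x), in which P is the derivative of the
    unknown.  Read from right to left, it builds degree n + 1 from degree n at
    the cost of lowering the parameter. *)
Lemma laguerre_neg_raise (R : realType) (b : R) (n : nat)
    (P := laguerre_neg (b + 1) n%:Z) :
  n.+1%:R *: laguerre_neg b n.+1%:Z = 'X * P^`() + ((b + 1)%:P + 'X) * P.
Proof. by rewrite -laguerre_neg_ode deriv_laguerre_neg. Qed.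

(** The degree is written n - 1 in the integers so that n = 0 is covered by the
    convention L_(-1) = 0. *)
Lemma deriv_laguerre (R : realType) (b : R) (n : nat) :
  laguerre (b + 1) (n%:Z - 1) = - (laguerre b n%:Z)^`().
Proof.
case: n => [|n].
  rewrite /= big_ord_recl big_ord0 addr0 expr0 derivZ.
  by rewrite (derivC 1) scaler0 oppr0.
have -> : n.+1%:Z - 1 = n%:Z by lia.
rewrite !laguerreE deriv_comp derivN derivX mulrN1 opprK.
by rewrite deriv_laguerre_neg.
Qed.

(** Only one Laguerre parameter remains in this form, so that the equation of
    [w] alone decides the behaviour at the nodes. *)
Lemma xlaguerreIE (R : realType) (a : R) (m n : nat)
    (w := laguerre_neg (a - 1) m%:Z) (f := laguerre (a - 1) n%:Z) :
  xlaguerreI m a (m + n) = (w + w^`()) * f - w * f^`().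
Proof.
have -> : a = a - 1 + 1 by ring.
rewrite /xlaguerreI.
have -> : (m + n)%:Z - m%:Z = n%:Z by lia.
by rewrite deriv_laguerre laguerre_neg_param mulrN addrK.
Qed.

(** * Real roots of Laguerre polynomials *)

Lemma sign_changes_roots (R : rcfType) (Q : {poly R}) (t : nat -> R) (n : nat) :
  (forall i, (i < n)%N -> t i.+1 < t i) ->
  (forall i, (i <= n)%N -> 0 < (-1) ^+ i * Q.[t i]) ->
  exists s : nat -> R,
    forall i, (i < n)%N -> [/\ t i.+1 < s i, s i < t i & root Q (s i)].
Proof.
move=> dec alt.
have H i : exists x, (i < n)%N -> [/\ t i.+1 < x, x < t i & root Q x].
  case: ltnP => [lt_in|_]; last by exists 0.
  have sgn : Q.[t i.+1] * Q.[t i] < 0.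
    have := mulr_gt0 (alt _ lt_in) (alt _ (ltnW lt_in)).
    by rewrite exprS mulN1r !mulNr oppr_gt0 mulrACA -expr2 sqrr_sign mul1r.
  have [x /itvP xI rx] := poly_ivtoo (ltW (dec _ lt_in)) sgn.
  by exists x; rewrite !xI.
by have [s sP] := choice H; exists s.
Qed.

(** The derivative at r_i is the product of r_i - r_j over j != i, whose
    negative factors are exactly those with j < i. *)
Lemma sign_deriv_prod_XsubC (R : realDomainType) (n : nat) (r : nat -> R) (i : 'I_n) :
  (forall j k, (j < k < n)%N -> r k < r j) ->
  0 < (-1) ^+ i * (\prod_(j < n) ('X - (r j)%:P))^`().[r i].
Proof.
move=> dec; rewrite (bigD1 i) //= derivM derivXsubC mul1r hornerD hornerM.
rewrite hornerXsubC subrr mul0r addr0 horner_prod.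
have -> : (-1) ^+ i = \prod_(j < n | j != i) (if (j < i)%N then -1 else 1) :> R.
  (* Distributes the sign over the factors that are negative. *)
  transitivity (\prod_(j < n) (if (j < i)%N then -1 else 1) : R).
    rewrite -big_mkcond -(big_ord_widen n (fun=> -1)) ?prodr_const ?card_ord //.
    exact: ltnW.
  by rewrite (bigD1 i) //= ltnn mul1r.
rewrite -big_split prodr_gt0 //= => j ji.
rewrite hornerXsubC; case: (ltngtP j i) => [lt_ji|lt_ij|/val_inj eq_ji].
- by rewrite mulN1r opprB subr_gt0 dec // lt_ji /=.
- by rewrite mul1r subr_gt0 dec // lt_ij /=.
- by rewrite eq_ji eqxx in ji.
Qed.

Lemma exists_left_sign (R : rcfType) (Q : {poly R}) (b : R) :
  0 < lead_coef Q -> exists2 x, x < b & 0 < (-1) ^+ (size Q).-1 * Q.[x].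
Proof.
move=> lQ.
have lQN : lead_coef ((-1) ^+ (size Q).-1 *: (Q \Po - 'X)) = lead_coef Q.
  rewrite lead_coefZ lead_coef_comp ?size_polyN ?size_polyX // lead_coefN.
  by rewrite lead_coefX mulrCA -expr2 sqrr_sign mulr1.
have [y yP] : exists y, forall x, y <= x ->
    lead_coef Q <= ((-1) ^+ (size Q).-1 *: (Q \Po - 'X)).[x].
  by rewrite -lQN; apply: poly_pinfty_gt_lc; rewrite lQN.
exists (- (Num.max y (1 - b))).
  by rewrite ltrNl lt_max [- b < 1 - _]ltrDr ltr01 orbT.
have /yP le_lc : y <= Num.max y (1 - b) by rewrite le_max lexx.
apply: (lt_le_trans lQ); apply: (le_trans le_lc).
by rewrite hornerZ horner_comp hornerN hornerX.
Qed.

Lemma uniq_decreasing (R : realDomainType) (n : nat) (r : nat -> R) :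
  (forall i j, (i < j < n)%N -> r j < r i) -> uniq [seq r i | i <- iota 0 n].
Proof.
move=> dec; rewrite map_inj_in_uniq ?iota_uniq // => i j.
rewrite !mem_iota /= => lt_in lt_jn rij.
case: (ltngtP i j) => // [lt_ij|lt_ji].
  by have := dec i j; rewrite lt_ij lt_jn rij ltxx => /(_ isT).
by have := dec j i; rewrite lt_ji lt_in rij ltxx => /(_ isT).
Qed.

(** Raising the parameter from b to b + 1 > 0 makes the value of x P' + (b+1+x) P
    at 0 equal to (b+1) P(0) > 0, while at a root r < 0 of P its value r P'(r) has
    the sign opposite to that of P'(r).  Negativity of the roots is part of the
    statement because this induction step uses it. *)
Lemma laguerre_neg_roots (R : realType) (n : nat) (b : R) : -1 < b ->
  exists r : nat -> R, [/\ forall i j, (i < j < n)%N -> r j < r i,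
    forall i, (i < n)%N -> r i < 0 &
    forall i, (i < n)%N -> root (laguerre_neg b n%:Z) (r i)].
Proof.
elim: n b => [|n IHn] b bgt.
  by exists (fun=> 0); split => [i j||]; rewrite ?ltn0 ?andbF.
have [|r [r_dec r_neg r_root]] := IHn (b + 1); first by lra.
set P := laguerre_neg (b + 1) n%:Z in r_root.
set Q := laguerre_neg b n.+1%:Z.
have QE x : n.+1%:R * Q.[x] = x * P^`().[x] + (b + 1 + x) * P.[x].
  by rewrite -hornerZ laguerre_neg_raise !hornerE.
have lP : 0 < lead_coef P := lead_coef_laguerre_neg_gt0 _ _ _.
have PE : P = lead_coef P *: \prod_(j < n) ('X - (r j)%:P).
  rewrite -(big_mkord xpredT (fun j => 'X - (r j)%:P)) -(big_map r xpredT
    (fun x => 'X - x%:P)).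
  apply: all_roots_prod_XsubC.
  - by rewrite size_laguerre_neg size_map size_iota subn0.
  - by apply/allP => x /mapP[i]; rewrite mem_index_iota => /= /r_root ? ->.
  - by rewrite uniq_rootsE /index_iota subn0 uniq_decreasing.
have P'r i : (i < n)%N -> 0 < (-1) ^+ i * P^`().[r i].
  move=> lt_in; rewrite PE derivZ hornerZ mulrCA mulr_gt0 //.
  exact: (@sign_deriv_prod_XsubC _ n r (Ordinal lt_in)).
have P0 : 0 < P.[0].
  rewrite PE hornerZ mulr_gt0 // horner_prod prodr_gt0 // => j _.
  by rewrite hornerXsubC sub0r oppr_gt0 r_neg.
have Qr i : (i < n)%N -> 0 < (-1) ^+ i.+1 * Q.[r i].
  move=> lt_in; rewrite -(pmulr_rgt0 _ (ltr0Sn R n)) mulrCA QE.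
  rewrite (rootP (r_root _ lt_in)) mulr0 addr0 exprS mulN1r mulNr mulrCA -mulNr.
  by rewrite mulr_gt0 ?oppr_gt0 ?r_neg ?P'r.
have Q0 : 0 < Q.[0].
  rewrite -(pmulr_rgt0 _ (ltr0Sn R n)) QE mul0r add0r addr0 mulr_gt0 //.
  by lra.
(* The n + 2 points where Q alternates: 0, the roots of P, and x. *)
pose t0 i := if i is j.+1 then r j else 0.
have [x xlt Qx] := @exists_left_sign _ Q (t0 n) (lead_coef_laguerre_neg_gt0 _ _ _).
rewrite size_laguerre_neg /= in Qx.
pose t i := if i == n.+1 then x else t0 i.
have tE i : (i <= n)%N -> t i = t0 i.
  by rewrite /t; case: eqP => // -> /[!ltnn].
have t_last : t n.+1 = x by rewrite /t eqxx.
have t_dec i : (i < n.+1)%N -> t i.+1 < t i.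
  rewrite ltnS leq_eqVlt => /orP[/eqP ->|lt_in].
    by rewrite t_last tE.
  rewrite !tE //; last exact: ltnW.
  by case: i lt_in => [|i] lt_in /=; [exact: r_neg|apply: r_dec; rewrite leqnn].
have [i|s sP] := @sign_changes_roots _ Q t n.+1 t_dec.
  rewrite leq_eqVlt => /orP[/eqP ->|]; first by rewrite t_last.
  rewrite ltnS => le_in; rewrite tE //.
  by case: i le_in => [|i] /=; [rewrite mul1r|exact: Qr].
have t_decW i j : (i <= j <= n.+1)%N -> t j <= t i.
  case/andP; elim: j => [|j IHj]; first by rewrite leqn0 => /eqP ->.
  rewrite leq_eqVlt => /orP[/eqP -> //|le_ij lt_jn].
  by apply: (le_trans (ltW (t_dec _ lt_jn))); apply: IHj => //; exact: ltnW.
exists s; split => [i j /andP[lt_ij lt_jn]|i lt_in|i /sP[]] //.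
  have [_ sj _] := sP _ lt_jn; have [si _ _] := sP _ (ltn_trans lt_ij lt_jn).
  apply: (lt_trans sj); apply: le_lt_trans si; apply: t_decW.
  by rewrite lt_ij /= ltnW.
have [_ si _] := sP _ lt_in.
apply: (lt_le_trans si); rewrite -[0]/(t0 0) -tE //; apply: t_decW => /=.
exact: ltnW.
Qed.

(** * Degrees and nodal conditions of the exceptional polynomials *)

Lemma xlaguerreI_cond (R : realType) (a : R) (m n : nat) (xi : R)
    (q := xlaguerreI m a (m + n)) :
  root (laguerre_neg (a - 1) m%:Z) xi -> xi * q^`().[xi] + a * q.[xi] = 0.
Proof.
move=> /rootP w0; rewrite {}/q xlaguerreIE.
move: (laguerre (a - 1) n%:Z) => f.
have := congr1 (horner^~ xi) (laguerre_neg_ode R (a - 1) m) => /=.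
move: (laguerre_neg (a - 1) m%:Z) w0 => w w0.
rewrite !derivE !hornerE w0 subrK mulr0 => ode.
(* At a root of w only the terms carrying the factor f(xi) survive. *)
transitivity ((xi * w^`()^`().[xi] + (a + xi) * w^`().[xi]) * f.[xi]); first by ring.
by rewrite ode mul0r.
Qed.

(** The leading term is that of w f; the other two products lose a degree through
    the derivative. *)
Lemma size_xlaguerreI (R : realType) (a : R) (m n : nat) :
  size (xlaguerreI m a (m + n)) = (m + n).+1.
Proof.
rewrite xlaguerreIE.
set w := laguerre_neg (a - 1) m%:Z; set f := laguerre (a - 1) n%:Z.
have sw : size w = m.+1 by exact: size_laguerre_neg.
have sf : size f = n.+1.
  rewrite /f laguerreE size_comp_poly2 ?size_laguerre_neg //.
  by rewrite size_polyN size_polyX.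
have w0 : w != 0 by rewrite -size_poly_eq0 sw.
have f0 : f != 0 by rewrite -size_poly_eq0 sf.
have swf : size (w * f) = (m + n).+1 by rewrite size_mul // sw sf addSn addnS.
have -> : (w + w^`()) * f - w * f^`() = w * f + (w^`() * f - w * f^`()) by ring.
rewrite size_polyDl swf // ltnS (leq_trans (size_polyD _ _)) // geq_max size_polyN.
apply/andP; split; apply: (leq_trans (size_polyMleq _ _)).
  by rewrite sf addnS /= leq_add2r -ltnS -sw lt_size_deriv.
by rewrite sw addSn /= leq_add2l -ltnS -sf lt_size_deriv.
Qed.

(** * Reduction to low degree *)

(** Division by a family with one member in each degree: cancel the leading
    coefficients from the top degree downwards. *)
Lemma reduce_graded (F : fieldType) (q : nat -> {poly F}) (m n : nat) (p : {poly F}) :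
  (forall j, (m <= j < n)%N -> size (q j) = j.+1) -> (m <= n)%N -> (size p <= n)%N ->
  exists c : nat -> F, (size (p - \sum_(m <= j < n) c j *: q j)%R <= m)%N.
Proof.
move=> sq /subnKC; move: (n - m)%N => d; elim: d n p sq => [|d IHd] n p /[swap] <- sq sp.
  by exists (fun=> 0); rewrite addn0 big_geq // subr0 -(addn0 m).
rewrite addnS in sq sp *.
have sqd : size (q (m + d)%N) = (m + d).+1.
  by apply: sq; rewrite leq_addr /=.
pose a := p`_(m + d) / lead_coef (q (m + d)%N).
have [||c cP] := IHd (m + d)%N (p - a *: q (m + d)%N) _ erefl.
- by move=> j /andP[mj jn]; rewrite sq // mj ltnW.
- apply/leq_sizeP => j; rewrite leq_eqVlt coefB coefZ => /orP[/eqP <-|lt_dj].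
    rewrite /a lead_coefE sqd /= divfK ?subrr //.
    rewrite -[X in _`_X]/(m + d).+1.-1 -sqd -lead_coefE lead_coef_eq0.
    by rewrite -size_poly_eq0 sqd.
  by rewrite !nth_default ?sqd // ?mulr0 ?subrr // (leq_trans sp).
exists (fun j => if j == (m + d)%N then a else c j).
rewrite big_nat_recr ?leq_addr //= eqxx.
rewrite (eq_big_nat _ _ (F2 := fun j => c j *: q j)) => [|j /andP[_ jn]].
  by rewrite opprD addrA addrAC.
by rewrite ltn_eqF.
Qed.

(** The operator x d/dx + a is diagonal on monomials with eigenvalues i + a > 0,
    so it preserves degrees and is injective; more zeros than the degree allows
    force its value, hence its argument, to vanish. *)
Lemma euler_cond_eq0 (R : realFieldType) (a : R) (r : {poly R}) (rs : seq R) :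
  0 < a -> uniq rs -> (size r <= size rs)%N ->
  {in rs, forall x, x * r^`().[x] + a * r.[x] = 0} -> r = 0.
Proof.
move=> a0 rs_uniq szr rP; pose e := 'X * r^`() + a *: r.
have coef_e i : e`_i = (i%:R + a) * r`_i.
  rewrite coefD coefXM coefZ mulrDl; congr (_ + _).
  by case: i => [|i] /=; rewrite ?mul0r // coef_deriv mulr_natl.
have e0 : e = 0.
  apply: (roots_geq_poly_eq0 (rs := rs)) => //.
    by apply/allP => x /rP xP; rewrite /root !hornerE xP.
  apply: leq_trans szr; apply/leq_sizeP => i le_i.
  by rewrite coef_e nth_default ?mulr0.
apply/polyP => i; have /eqP := coef_e i.
rewrite e0 coef0 eq_sym mulf_eq0 => /orP[|/eqP //].
by rewrite gt_eqF // ltr_wpDl.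
Qed.

(** * The span and the nodal conditions *)

Theorem lemma3p1 (R : realType) (alpha : R) (halpha : 0 < alpha)
    (m : nat) (hm : (0 < m)%N) (k : nat) :
  spanXL alpha m k = condXL alpha m k.
Proof.
have span_cond c (xi : R) (q := \sum_(m <= j < (m + k).+1) c j *: xlaguerreI m alpha j) :
    root (laguerre_neg (alpha - 1) m%:Z) xi -> xi * q^`().[xi] + alpha * q.[xi] = 0.
  move=> rxi; rewrite {}/q big_seq; elim/big_rec: _ => [|j q].
    by rewrite deriv0 !horner0 !mulr0 addr0.
  rewrite mem_index_iota => /andP[mj _] qP.
  have := xlaguerreI_cond R alpha m (j - m) xi rxi; rewrite subnKC //.
  move: (xlaguerreI m alpha j) => x xP; rewrite !derivE !hornerE.
  rewrite -[RHS](mulr0 (c j)) -xP -[RHS]addr0 -qP; ring.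
have sxl j : (m <= j)%N -> size (xlaguerreI m alpha j) = j.+1.
  by move=> mj; rewrite -{1}(subnKC mj) size_xlaguerreI subnKC.
apply/seteqP; split => p /=.
  case=> c ->; split; last by move=> xi; exact: span_cond.
  apply: (leq_trans (size_sum _ _ _)).
  apply/bigmax_leqP_seq => j; rewrite mem_index_iota => /andP[mj jk] _.
  by rewrite (leq_trans (size_scale_leq _ _)) // sxl.
case=> szp pP.
have [||c cP] := @reduce_graded _ (xlaguerreI m alpha) m _ p _ _ szp.
- by move=> j /andP[/sxl].
- by rewrite leqW ?leq_addr.
exists c; apply/eqP; rewrite -subr_eq0; apply/eqP.
have [|r [r_dec _ r_root]] := laguerre_neg_roots R m (alpha - 1); first by lra.
apply: (@euler_cond_eq0 _ alpha _ [seq r i | i <- iota 0 m]) => //.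
- exact: uniq_decreasing.
- by rewrite size_map size_iota.
- move=> _ /mapP[i /[!mem_iota] /= /r_root ri ->].
  move: (\sum_(m <= j < _) _) (span_cond c _ ri) (pP _ ri) => q qP {}pP.
  rewrite !derivE !hornerE -[RHS](subrr 0) -{1}pP -qP; ring.
Qed.
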